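(* Let $\mathbf{k}$ be a field with characteristic not equal to $2$. Let $\Gamma$ be a finite simple graph with vertices $V$ and edges $E$, in which each vertex $i\in V$ is labeled with a weight $p_i\in\mathbb{Z}_{>0}$ and each edge $j\in E$, with endpoints $a_j,b_j$, is labeled with a weight $q_j\in\mathbb{Z}/2\mathbb{Z}$. Let $R=\mathbf{k}\langle x_i,\ i\in V\rangle$ be the free associative algebra graded by $|x_i|=p_i$. For $j\in E$ let $[x_{a_j},x_{b_j}]$ denote $x_{a_j}x_{b_j}-(-1)^{q_j}x_{b_j}x_{a_j}$, and let $I(\Gamma)$ be the two-sided ideal of $R$ generated by $\{[x_{a_j},x_{b_j}],\ j\in E\}$. Then the associative (noncommutative) graded algebra $A=R/I(\Gamma)$ has Hilbert series $$H_A(z)=\left[c_\Gamma(z)\right]^{-1},$$ where $c_\Gamma(z)$ is the clique polynomial of $\Gamma$.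
   Context: The clique polynomial of $\Gamma$ (which uses only the vertex weights) is $c_\Gamma(z)=\sum_{i\ge 0}\sum_{j\ge 0}(-1)^i c_{i,j}z^j$, where $c_{i,j}$ is the number of complete subgraphs of $\Gamma$ with $i$ vertices whose weights sum to $j$ (with $c_{0,0}=1$ for the empty clique). The Hilbert series of a non-negatively graded $\mathbf{k}$-algebra $A=\bigoplus_{n\ge0}A_n$ with finite-dimensional pieces is $H_A(z)=\sum_{n\ge0}(\dim_{\mathbf{k}}A_n)z^n$; inverses are taken in the ring of formal power series in $z$ over $\mathbb{Z}$. *)

(* Defs.v *)
From HB Require Import structures.
From mathcomp Require Import all_boot all_order all_algebra.
From mathcomp Require Import generic_quotient ring_quotient.
From mathcomp Require Import finmap.
From mathcomp.multinomials Require Import monalg.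
From mathcomp.classical Require Import boolp.

Set Implicit Arguments.
Unset Strict Implicit.
Unset Printing Implicit Defensive.

Import GRing.Theory.

Local Open Scope ring_scope.

(* Edges form a finite type with a chosen ordering (endl, endr) of the two     *)
(* endpoints; simplicity says that there are no loops and that distinct edges  *)
(* have distinct endpoint sets.                                                *)
Record wgraph := WGraph {
  vert : finType;
  edge : finType;
  endl : edge -> vert;
  endr : edge -> vert;
  no_loop : forall j, endl j != endr j;
  no_multi_edge : injective (fun j => [set endl j; endr j]);
  vweight : vert -> nat;
  vweight_gt0 : forall i, (0 < vweight i)%N;
  eweight : edge -> 'Z_2
}.

Section CliquePolynomial.
Variable G : wgraph.

Definition adjacent (u v : vert G) : bool :=
  [exists j : edge G, [set endl j; endr j] == [set u; v]].

Definition is_clique (C : {set vert G}) : bool :=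
  [forall u in C, forall v in C, (u != v) ==> adjacent u v].

Definition clique_count (i j : nat) : nat :=
  #|[set C : {set vert G} |
      [&& is_clique C, #|C| == i & (\sum_(v in C) vweight v)%N == j]]|.

(* The bounds on i and j lose nothing: a clique has at most #|vert G| vertices *)
(* and at most the total vertex weight.                                        *)
Definition clique_poly : {poly int} :=
  \sum_(i < #|vert G|.+1) \sum_(j < (\sum_(v : vert G) vweight v)%N.+1)
    ((-1) ^+ i * (clique_count i j)%:Z) *: 'X^j.

End CliquePolynomial.

Section QuotientAlgebra.
Variables (k : fieldType) (G : wgraph).

Local Notation free_alg := {malg k[{fmonom vert G}]}.

Definition gen (i : vert G) : free_alg := << fmu i >>.

Definition relator (j : edge G) : free_alg :=
  gen (endl j) * gen (endr j)
    - (-1) ^+ (eweight j) *: (gen (endr j) * gen (endl j)).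

(* I(G), as the set of finite sums of elements f * relator j * g. *)
Definition rel_ideal_prop (r : free_alg) : Prop :=
  exists s : seq (free_alg * edge G * free_alg),
    r = \sum_(t <- s) t.1.1 * relator t.1.2 * t.2.

Definition rel_ideal : {pred free_alg} := fun r => `[< rel_ideal_prop r >].

Lemma rel_idealP r : reflect (rel_ideal_prop r) (r \in rel_ideal).
Proof. exact: asboolP. Qed.

Lemma rel_idealD r1 r2 :
  r1 \in rel_ideal -> r2 \in rel_ideal -> r1 + r2 \in rel_ideal.
Proof.
move=> /rel_idealP[s1 ->] /rel_idealP[s2 ->]; apply/rel_idealP.
by exists (s1 ++ s2); rewrite big_cat.
Qed.

Lemma rel_idealMl f r : r \in rel_ideal -> f * r \in rel_ideal.
Proof.
move=> /rel_idealP[s ->]; apply/rel_idealP.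
exists [seq (f * t.1.1, t.1.2, t.2) | t <- s].
by rewrite big_map mulr_sumr; apply: eq_bigr => t _ /=; rewrite !mulrA.
Qed.

Lemma rel_idealMr f r : r \in rel_ideal -> r * f \in rel_ideal.
Proof.
move=> /rel_idealP[s ->]; apply/rel_idealP.
exists [seq (t.1, t.2 * f) | t <- s].
by rewrite big_map mulr_suml; apply: eq_bigr => t _ /=; rewrite !mulrA.
Qed.

Lemma rel_idealZ c r : r \in rel_ideal -> c *: r \in rel_ideal.
Proof. by move=> Ir; rewrite -[r]mul1r scalerAl rel_idealMl. Qed.

Lemma rel_ideal_zmod : zmod_closed rel_ideal.
Proof.
split=> [|r1 r2 Ir1 Ir2]; first by apply/rel_idealP; exists [::]; rewrite big_nil.
by apply: rel_idealD => //; rewrite -scaleN1r rel_idealZ.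
Qed.

HB.instance Definition _ := GRing.isZmodClosed.Build free_alg rel_ideal
  rel_ideal_zmod.

Lemma rel_ideal1 : 1 \notin rel_ideal.
Proof.
apply/rel_idealP => -[s E1].
pose c1 : {rmorphism {malg k[{fmonom vert G}]} -> k} := mcoeff mone.
have gen0 i : c1 (gen i) = 0 by rewrite /c1 /= mcoeffU1 fm1_eq1.
move: (congr1 c1 E1) => /eqP; apply/negP.
rewrite rmorph1 rmorph_sum big1 ?oner_eq0 // => t _.
rewrite !rmorphM rmorphB [c1 (_ *: _)]mcoeffZ -/(c1 _) !rmorphM !gen0.
by rewrite !mul0r mulr0 subr0 mulr0 mul0r.
Qed.

(* MathComp's quotient by an ideal is an algebra only over a commutative ring, *)
(* so the multiplicative and scalar structure is added to its zmodType         *)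
(* quotient by hand.                                                           *)
Definition quot_alg := Quotient.quot rel_ideal.
HB.instance Definition _ := Choice.on quot_alg.
HB.instance Definition _ := GRing.Zmodule.on quot_alg.

Definition proj : free_alg -> quot_alg := \pi_quot_alg%qT.

Lemma proj_repr x : proj (repr x) = x.
Proof. exact: reprK. Qed.

Lemma projP r1 r2 : reflect (proj r1 = proj r2) (r1 - r2 \in rel_ideal).
Proof. by rewrite Quotient.idealrBE; exact: eqP. Qed.

Lemma projB : {morph proj : r1 r2 / r1 - r2}.
Proof. exact: raddfB. Qed.

Lemma projD : {morph proj : r1 r2 / r1 + r2}.
Proof. exact: raddfD. Qed.

Definition quot_mul (x y : quot_alg) : quot_alg := proj (repr x * repr y).
Definition quot_scale (c : k) (x : quot_alg) : quot_alg := proj (c *: repr x).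

Lemma projM r1 r2 : proj (r1 * r2) = quot_mul (proj r1) (proj r2).
Proof.
apply/projP; set s1 := repr _; set s2 := repr _.
have -> : r1 * r2 - s1 * s2 = r1 * (r2 - s2) + (r1 - s1) * s2.
  by rewrite mulrBr mulrBl addrA subrK.
apply: rel_idealD; [apply: rel_idealMl | apply: rel_idealMr];
  by apply/projP; rewrite proj_repr.
Qed.

Lemma projZ c r : proj (c *: r) = quot_scale c (proj r).
Proof.
by apply/projP; rewrite -scalerBr rel_idealZ //; apply/projP; rewrite proj_repr.
Qed.

Lemma quot_mulA : associative quot_mul.
Proof.
move=> x y z; rewrite -[x]proj_repr -[y]proj_repr -[z]proj_repr.
by rewrite -!projM mulrA.
Qed.

Lemma quot_mul1 : left_id (proj 1) quot_mul.
Proof. by move=> x; rewrite -[x]proj_repr -projM mul1r. Qed.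

Lemma quot_mulr1 : right_id (proj 1) quot_mul.
Proof. by move=> x; rewrite -[x]proj_repr -projM mulr1. Qed.

Lemma quot_mulDl : left_distributive quot_mul +%R.
Proof.
move=> x y z; rewrite -[x]proj_repr -[y]proj_repr -[z]proj_repr.
by rewrite -projD -!projM -projD mulrDl.
Qed.

Lemma quot_mulDr : right_distributive quot_mul +%R.
Proof.
move=> x y z; rewrite -[x]proj_repr -[y]proj_repr -[z]proj_repr.
by rewrite -projD -!projM -projD mulrDr.
Qed.

Lemma quot_oner_neq0 : proj 1 != 0.
Proof.
apply/eqP => /esym p10; move: rel_ideal1; rewrite -[1 in X in _ X]subr0.
by move/projP; apply; rewrite -p10 [RHS]raddf0.
Qed.

HB.instance Definition _ := GRing.Zmodule_isNzRing.Build quot_alg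
  quot_mulA quot_mul1 quot_mulr1 quot_mulDl quot_mulDr quot_oner_neq0.

Lemma quot_scaleA c d x : quot_scale c (quot_scale d x) = quot_scale (c * d) x.
Proof. by rewrite -[x]proj_repr -!projZ scalerA. Qed.

Lemma quot_scale1 : left_id 1 quot_scale.
Proof. by move=> x; rewrite -[x]proj_repr -projZ scale1r. Qed.

Lemma quot_scaleDr : right_distributive quot_scale +%R.
Proof.
move=> c x y; rewrite -[x]proj_repr -[y]proj_repr.
by rewrite -projD -!projZ -projD scalerDr.
Qed.

Lemma quot_scaleDl x : {morph quot_scale^~ x : c d / c + d}.
Proof.
by move=> c d; rewrite -[x]proj_repr -!projZ -projD scalerDl.
Qed.

HB.instance Definition _ := GRing.Zmodule_isLmodule.Build k quot_alg
  quot_scaleA quot_scale1 quot_scaleDr quot_scaleDl.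

Lemma quot_scaleAl c (x y : quot_alg) : c *: (x * y) = c *: x * y.
Proof.
rewrite -[x]proj_repr -[y]proj_repr.
by rewrite /GRing.scale /GRing.mul /= -projM -!projZ -projM scalerAl.
Qed.

HB.instance Definition _ := GRing.Lmodule_isLalgebra.Build k quot_alg
  quot_scaleAl.

Lemma free_scaleAr c (f g : free_alg) : c *: (f * g) = f * (c *: g).
Proof.
rewrite -!mul_malgC !mulrA; congr (_ * _).
rewrite !malgM_def fgmulUg fgmulgU; apply: eq_bigr => w _.
by rewrite mul1m mulm1 mulrC.
Qed.

Lemma quot_scaleAr c (x y : quot_alg) : c *: (x * y) = x * (c *: y).
Proof.
rewrite -[x]proj_repr -[y]proj_repr.
by rewrite /GRing.scale /GRing.mul /= -projM -!projZ -projM free_scaleAr.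
Qed.

HB.instance Definition _ := GRing.Lalgebra_isAlgebra.Build k quot_alg
  quot_scaleAr.

Lemma proj_is_zmod_morphism : zmod_morphism proj.
Proof. exact: projB. Qed.

HB.instance Definition _ := GRing.isZmodMorphism.Build free_alg quot_alg proj
  proj_is_zmod_morphism.

Lemma proj_is_monoid_morphism : monoid_morphism proj.
Proof. by split=> // r1 r2; rewrite projM. Qed.

HB.instance Definition _ := GRing.isMonoidMorphism.Build free_alg quot_alg proj
  proj_is_monoid_morphism.

Lemma proj_is_scalable : scalable proj.
Proof. by move=> c r; rewrite projZ. Qed.

HB.instance Definition _ := GRing.isScalable.Build k free_alg quot_alg *:%R proj
  proj_is_scalable.

Definition word_weight (w : {fmonom vert G}) : nat :=
  (\sum_(i <- fmonom_val w) vweight i)%N.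

Definition free_piece (n : nat) (f : free_alg) : Prop :=
  forall w, w \in msupp f -> word_weight w = n.

(* A_n, the image of R_n. *)
Definition quot_piece (n : nat) (x : quot_alg) : Prop :=
  exists2 f, free_piece n f & proj f = x.

End QuotientAlgebra.

Section HilbertSeries.
Variables (k : fieldType) (M : lmodType k).

Definition has_dim (S : M -> Prop) (d : nat) : Prop :=
  exists e : 'I_d -> M,
    [/\ forall i, S (e i),
        forall c : 'I_d -> k, \sum_i c i *: e i = 0 -> forall i, c i = 0
      & forall x, S x -> exists c : 'I_d -> k, x = \sum_i c i *: e i].

Definition is_hilbert_series (piece : nat -> M -> Prop) (H : nat -> int) : Prop :=
  forall n, exists2 d : nat, has_dim (piece n) d & H n = d%:Z.

End HilbertSeries.

(* Formal power series over Z are represented by their coefficient sequences. *)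
Definition fps_one (n : nat) : int := (n == 0)%:R.

Definition fps_mul (f g : nat -> int) (n : nat) : int :=
  \sum_(i < n.+1) f i * g (n - i)%N.

Definition fps_of_poly (P : {poly int}) (n : nat) : int := P`_n.

Definition is_fps_inverse (f g : nat -> int) : Prop :=
  fps_mul f g =1 fps_one /\ fps_mul g f =1 fps_one.

(* Main.v *)
Require Import Defs.
From HB Require Import structures.
From mathcomp Require Import all_boot all_order all_algebra.
From mathcomp Require Import finmap.
From mathcomp.multinomials Require Import monalg.

(* Traces (words modulo exchanges of neighbouring letters joined by an edge)   *)
(* index a basis of A: signs can be attached to inversions so that the signed  *)
(* sum of the coefficients over a trace is a functional vanishing on I(Gamma), *)
(* while modulo I(Gamma) a word is, up to a scalar, any other word of its      *)
(* trace. Traces are then counted by the Cartier-Foata identity.               *)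

Set Implicit Arguments.
Unset Strict Implicit.
Unset Printing Implicit Defensive.

Import GRing.Theory.

Local Open Scope ring_scope.

(** In A, exchanging two neighbouring letters joined by an edge costs only a sign, so A_n is spanned
    by one word for each trace of weight n ([word_class_trace_eq]). For independence, fix a total
    order on the vertices and let [word_sign] multiply the edge signs over the inversions of a word.
    Its ratio on two words that differ by an exchange is the sign in the relator, so the sum of
    coefficients over a trace, weighted by [word_sign], kills I(Gamma) ([trace_coef_ideal]), and
    these functionals separate traces. Hence dim A_n is the number of traces of weight n
    ([quot_piece_dim]), whatever the q_j.

    The generating series of traces is inverted by [clique_traces_inverse]. The letters that can be
    moved to the front of a trace w form a clique F, and the factorizations w = C t with C a clique
    correspond to the subsets C of F. The sum of (-1)^|C| over these subsets is 0 unless F, hence w,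
    is empty. *)

Lemma sum_powerset_sign (T : finType) (M : {set T}) :
  \sum_(C : {set T} | C \subset M) (-1) ^+ #|C| = (M == set0)%:R :> int.
Proof.
(* Expand the product over v of 1 - [v in M]: a set not contained in M contributes 0, and the
   product itself has a zero factor unless M is empty. *)
have := bigA_distr 1 +%R (fun v => - (v \in M)%:R : int) (fun=> 1).
set S := \big[_/_]_(J in _) _ => E; transitivity S; last first.
  rewrite -E; have [->|[v vM]] := set_0Vmem M.
    by rewrite eqxx big1 // => v _; rewrite /= inE oppr0 add0r.
  rewrite (bigD1 v) //= vM /= addNr mul0r.
  by case: eqP vM => // ->; rewrite inE.
rewrite big_mkcond; apply: eq_bigr => C _; case: ifPn => [CM|/subsetPn[v vC vM]].
  rewrite -[RHS]big_mkcond /= -prodr_const; apply: eq_bigr => v vC.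
  by rewrite (subsetP CM).
by rewrite (bigD1 v) //= vC (negPf vM) oppr0 mul0r.
Qed.

(** Reduces the vanishing of a functional on f x g to the case where f and g are scaled
    monomials. *)
Lemma sum_mul_sum_eq0 (A : pzRingType) (U : zmodType) (phi : {additive A -> U})
    (I J : Type) (s : seq I) (t : seq J) (F : I -> A) (E : J -> A) x :
  (forall i j, phi (F i * x * E j) = 0) ->
  phi ((\sum_(i <- s) F i) * x * (\sum_(j <- t) E j)) = 0.
Proof.
move=> phi0; rewrite mulr_suml mulr_suml raddf_sum big1 // => i _.
by rewrite mulr_sumr raddf_sum big1.
Qed.

(** * Trace equivalence, front letters and normal forms *)

Section Traces.
Variables (V : finType) (comm : rel V).
Hypothesis comm_sym : symmetric comm.
Hypothesis comm_irr : irreflexive comm.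
Implicit Types (a b c v : V) (s t w : seq V).

(* Projections onto pairs of non-commuting letters determine a trace; taking   *)
(* this as the definition makes decidability and cancellation immediate.       *)
Definition trace_eq w1 w2 :=
  [forall a, forall b,
    comm a b || ([seq x <- w1 | pred2 a b x] == [seq x <- w2 | pred2 a b x])].

Lemma trace_eqP w1 w2 :
  reflect (forall a b, ~~ comm a b ->
             [seq x <- w1 | pred2 a b x] = [seq x <- w2 | pred2 a b x])
          (trace_eq w1 w2).
Proof.
apply: (iffP forallP) => [E a b /negPf ab | E a].
  by have /forallP/(_ b) := E a; rewrite ab => /eqP.
by apply/forallP=> b; case: (boolP (comm a b)) => //= ab; apply/eqP/E.
Qed.

Lemma trace_eq_refl : reflexive trace_eq.
Proof. by move=> w; apply/trace_eqP. Qed.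

Lemma trace_eq_sym : symmetric trace_eq.
Proof.
by move=> w1 w2; apply/trace_eqP/trace_eqP => E a b ab; rewrite E.
Qed.

Lemma trace_eq_trans : transitive trace_eq.
Proof.
move=> w2 w1 w3 /trace_eqP E1 /trace_eqP E2.
by apply/trace_eqP => a b ab; rewrite E1 ?E2.
Qed.

Lemma trace_eq_catl s w1 w2 : trace_eq (s ++ w1) (s ++ w2) = trace_eq w1 w2.
Proof.
apply/trace_eqP/trace_eqP => E a b /E; rewrite !filter_cat; last by move->.
by move/eqP; rewrite eqseq_cat // eqxx => /eqP.
Qed.

Lemma trace_eq_cons a w1 w2 : trace_eq (a :: w1) (a :: w2) = trace_eq w1 w2.
Proof. exact: (trace_eq_catl [:: a]). Qed.

Lemma trace_eq_swap a b w :
  comm a b -> trace_eq (a :: b :: w) (b :: a :: w).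
Proof.
move=> ab; apply/trace_eqP => c d cd /=.
(* A projection onto a non-commuting pair cannot keep both a and b, so it does not see their
   order. *)
have ncomm : ~~ ((a == c) || (a == d)) || ~~ ((b == c) || (b == d)).
  rewrite -negb_and; apply: contra cd => /andP[/orP[]/eqP<- /orP[]/eqP E];
  by move: ab; rewrite E ?comm_irr // comm_sym.
by move: ncomm; case: ((a == c) || _); case: ((b == c) || _).
Qed.

(** No letter commutes with itself, so the projections onto pairs (a, a) are available; they count
    the occurrences of a. *)
Lemma trace_eq_perm w1 w2 : trace_eq w1 w2 -> perm_eq w1 w2.
Proof.
move=> /trace_eqP E; apply/allP=> a _ /=.
have /(congr1 size) := E a a (negbT (comm_irr a)).
by rewrite !size_filter => /eqP; congr (_ == _); apply: eq_count => x /=;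
  rewrite orbb.
Qed.

(** The letter b occurs in w and commutes with everything before its first occurrence, so it can be
    moved to the front. *)
Fixpoint front b w :=
  if w is a :: s then (a == b) || comm a b && front b s else false.

(** Rephrases [front] through the projections defining [trace_eq], so that it depends only on the
    trace. The case c = b says that b occurs in w. *)
Lemma frontP b w :
  reflect (forall c, ~~ comm b c ->
             ohead [seq x <- w | pred2 b c x] = Some b)
          (front b w).
Proof.
apply: (iffP idP).
  elim: w => //= a w IHw; have [-> //|nab /=] := eqVneq a b.
  case/andP=> ab fw c bc; case: eqVneq => [ac|_]; last exact: IHw.
  by move: ab bc; rewrite ac comm_sym => ->.
elim: w => [|a w IHw] /= E.
  by have := E b (negbT (comm_irr b)).
have [//|nab /=] := eqVneq a b.
have [ab|nab'] := boolP (comm a b).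
  apply: IHw => c bc; have := E c bc; rewrite (negPf nab) /=.
  by case: eqVneq => // ac; move: ab bc; rewrite ac comm_sym => ->.
have := E a; rewrite comm_sym nab' eqxx orbT /= => /(_ isT) [] /eqP.
by rewrite (negPf nab).
Qed.

Lemma eq_front b w1 w2 : trace_eq w1 w2 -> front b w1 = front b w2.
Proof.
by move=> /trace_eqP E; apply/frontP/frontP => F c bc; rewrite -(F c bc) E.
Qed.

Lemma front_rem b w : front b w -> trace_eq w (b :: rem b w).
Proof.
elim: w => //= a w IHw; have [-> _|nab /=] := eqVneq a b.
  exact: trace_eq_refl.
case/andP=> ab /IHw E; apply: (@trace_eq_trans (a :: b :: rem b w)).
  by rewrite trace_eq_cons.
exact: trace_eq_swap.
Qed.

Lemma front_cat b s w :
  b \in s -> (forall a, a \in s -> (a == b) || comm a b) -> front b (s ++ w).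
Proof.
elim: s => //= a s IHs; rewrite inE eq_sym => /orP[-> //|bs] C.
have [//|nab] := eqVneq a b.
have := C a; rewrite mem_head (negPf nab) => /(_ isT) /= -> /=.
by apply: IHs => // c cs; apply: C; rewrite inE cs orbT.
Qed.

Definition front_set w := [set b | front b w].

(** Whichever letter occurs later in w has to commute past the other. Hence [front_set w] is a
    clique. *)
Lemma front_comm w a b : front a w -> front b w -> a != b -> comm a b.
Proof.
elim: w => //= c w IHw.
case: (eqVneq c a) => [->|ca] /= => [_ /orP[->//|/andP[]//]|].
case/andP=> cca fa; case: (eqVneq c b) => [<- _ _|cb] /=.
  by rewrite comm_sym.
by case/andP=> _; apply: IHw.
Qed.

Lemma front_set_eq0 w : (front_set w == set0) = (w == [::]).
Proof.
case: w => [|a w]; last first.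
  by apply/negbTE/set0Pn; exists a; rewrite inE /= eqxx.
have -> : front_set [::] = set0 by apply/setP => b; rewrite !inE.
by rewrite !eqxx.
Qed.

(** Pull the letters of s out one by one: a front letter other than a remains a front letter once a
    has been removed. *)
Lemma fronts_factor s w :
  uniq s -> (forall b, b \in s -> front b w) -> exists t, trace_eq w (s ++ t).
Proof.
elim: s w => [|a s IHs] w /=; first by exists w; apply: trace_eq_refl.
case/andP=> aNs us F; have E := front_rem (F a (mem_head a s)).
have [|t Et] := IHs (rem a w) us; last first.
  by exists t; apply: trace_eq_trans E _; rewrite trace_eq_cons.
move=> b bs; have := F b; rewrite inE bs orbT (eq_front _ E) /= => /(_ isT).
by case: eqP => [ab|_ /andP[]//]; rewrite ab bs in aNs.
Qed.

(** Since [choose] sees only the equivalence class, this picks one representative word per trace. *)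
Definition canon w : seq V := choose (trace_eq w) w.

Lemma canonP w : trace_eq w (canon w).
Proof. by apply: (@chooseP _ (trace_eq w)); apply: trace_eq_refl. Qed.

Lemma eq_canon w1 w2 : trace_eq w1 w2 -> canon w1 = canon w2.
Proof.
move=> E; rewrite /canon; have Ee: trace_eq w1 =1 trace_eq w2.
  by move=> t; apply/idP/idP; apply: trace_eq_trans; rewrite // trace_eq_sym.
rewrite (eq_choose Ee); apply: choose_id;
  by rewrite ?trace_eq_refl // trace_eq_sym.
Qed.

Lemma canon_id w : canon (canon w) = canon w.
Proof. by apply: eq_canon; rewrite trace_eq_sym canonP. Qed.

(** * Enumerating traces by weight *)

Variable wt : V -> nat.
Hypothesis wt_gt0 : forall v, (0 < wt v)%N.

Definition wordwt w := (\sum_(v <- w) wt v)%N.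

Lemma leq_size_wordwt w : (size w <= wordwt w)%N.
Proof. by rewrite -sum1_size; apply: leq_sum => v _; apply: wt_gt0. Qed.

Lemma eq_wordwt w1 w2 : trace_eq w1 w2 -> wordwt w1 = wordwt w2.
Proof. by move=> E; apply/perm_big/trace_eq_perm. Qed.

Lemma wordwt_cat s t : wordwt (s ++ t) = (wordwt s + wordwt t)%N.
Proof. exact: big_cat. Qed.

(** Weights are positive, so a word of weight n has at most n letters and the enumeration is
    finite. *)
Definition words (n : nat) : seq (seq V) :=
  [seq w <- map val (enum {: n.-bseq V}) | wordwt w == n].

Lemma words_uniq n : uniq (words n).
Proof. by rewrite filter_uniq // map_inj_uniq ?enum_uniq //; apply: val_inj. Qed.

Lemma mem_words n w : (w \in words n) = (wordwt w == n).
Proof.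
rewrite mem_filter andb_idr // => /eqP wn.
have sw : (size w <= n)%N by rewrite -wn leq_size_wordwt.
by apply/mapP; exists (Bseq sw); rewrite // mem_enum.
Qed.

Definition traces n := [seq w <- words n | canon w == w].

Lemma traces_uniq n : uniq (traces n).
Proof. by rewrite filter_uniq ?words_uniq. Qed.

Lemma mem_traces n w : (w \in traces n) = (canon w == w) && (wordwt w == n).
Proof. by rewrite mem_filter mem_words. Qed.

Lemma canon_traces w : canon w \in traces (wordwt w).
Proof. by rewrite mem_traces canon_id eqxx -(eq_wordwt (canonP w)) /=. Qed.

(** * Cliques and the Cartier-Foata identity *)

Definition clique (C : {set V}) :=
  [forall u in C, forall v in C, (u != v) ==> comm u v].

Lemma cliqueP (C : {set V}) :
  reflect {in C &, forall u v, u != v -> comm u v} (clique C).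
Proof.
apply: (iffP forall_inP) => [K u v uC vC uv|K u uC].
  by have /forall_inP/(_ v vC)/implyP/(_ uv) := K u uC.
by apply/forall_inP => v vC; apply/implyP; apply: K.
Qed.

Definition setwt (C : {set V}) := (\sum_(v in C) wt v)%N.

Lemma wordwt_enum (C : {set V}) : wordwt (enum C) = setwt C.
Proof. by rewrite /wordwt big_enum. Qed.

Lemma sub_front_set (C : {set V}) w :
  C \subset front_set w -> exists t, trace_eq w (enum C ++ t).
Proof.
move=> /subsetP sC; apply: fronts_factor (enum_uniq _) _ => b.
by rewrite mem_enum => /sC; rewrite inE.
Qed.

Lemma clique_sub_front (C : {set V}) w t :
  clique C -> trace_eq w (enum C ++ t) -> C \subset front_set w.
Proof.
move=> /cliqueP KC E; apply/subsetP => b bC; rewrite inE (eq_front _ E).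
apply: front_cat => [|a]; rewrite mem_enum // => aC.
by case: eqVneq => //= ab; apply: KC.
Qed.

(** Prepending C to t is a bijection onto the traces whose front contains C; injectivity is left
    cancellation. The test guards against truncated subtraction, which would otherwise count the
    empty trace. *)
Lemma count_clique_front (C : {set V}) n : clique C ->
  count (fun w => C \subset front_set w) (traces n) =
    (if setwt C <= n then size (traces (n - setwt C)) else 0)%N.
Proof.
move=> KC; case: leqP => [le_Cn | lt_nC]; last first.
  rewrite (@eq_in_count _ _ pred0) ?count_pred0 // => w.
  rewrite mem_traces => /andP[_ /eqP wn]; apply/negP => /sub_front_set[t E].
  move: lt_nC; rewrite ltnNge -wn (eq_wordwt E) wordwt_cat wordwt_enum.
  by rewrite leq_addr.
rewrite -size_filter -(size_map (fun t => canon (enum C ++ t)) (traces _)).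
apply/perm_size/uniq_perm; first by rewrite filter_uniq ?traces_uniq.
  rewrite map_inj_in_uniq ?traces_uniq // => t1 t2.
  rewrite !mem_traces => /andP[/eqP c1 _] /andP[/eqP c2 _] E.
  rewrite -c1 -c2; apply: eq_canon; rewrite -(trace_eq_catl (enum C)).
  by apply: trace_eq_trans (canonP _) _; rewrite E trace_eq_sym canonP.
move=> w; rewrite mem_filter mem_traces.
apply/andP/mapP => [[/sub_front_set[t E] /andP[/eqP cw /eqP wn]] | [t]].
  have Ec : trace_eq w (enum C ++ canon t).
    by apply: trace_eq_trans E _; rewrite trace_eq_catl canonP.
  exists (canon t); last by rewrite -cw; apply: eq_canon.
  suff <- : wordwt t = (n - setwt C)%N by apply: canon_traces.
  by rewrite -wn (eq_wordwt E) wordwt_cat wordwt_enum addKn.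
rewrite mem_traces => /andP[_ /eqP wt_t] ->; split.
  by apply: (@clique_sub_front _ _ t) => //; rewrite trace_eq_sym canonP.
rewrite canon_id eqxx -(eq_wordwt (canonP _)) wordwt_cat.
by rewrite wordwt_enum wt_t subnKC /=.
Qed.

Definition clique_coef n : int :=
  \sum_(C : {set V} | clique C && (setwt C == n)) (-1) ^+ #|C|.

(* Writing a trace w as C t with C a clique amounts to choosing a subset C of  *)
(* the front of w, so the signs cancel unless w is empty.                      *)
Lemma clique_traces_inverse n :
  \sum_(i < n.+1) clique_coef i * (size (traces (n - i)))%:Z = (n == 0%N)%:R.
Proof.
transitivity (\sum_(C : {set V} | clique C)
    (-1) ^+ #|C| * (count (fun w => C \subset front_set w) (traces n))%:Z).
  transitivity (\sum_(i < n.+1) \sum_(C : {set V} | clique C && (setwt C == i))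
      (-1) ^+ #|C| * (size (traces (n - setwt C)))%:Z).
    apply: eq_bigr => i _; rewrite mulr_suml; apply: eq_bigr => C /andP[_].
    by move/eqP ->.
  under eq_bigr do rewrite big_mkcondr /=.
  rewrite exchange_big /=; apply: eq_bigr => C KC.
  rewrite count_clique_front //; case: leqP => [le_Cn | lt_nC].
    have lt_Cn : (setwt C < n.+1)%N by [].
    rewrite (bigD1 (Ordinal lt_Cn)) //= eqxx big1 ?addr0 // => i ni.
    by case: eqP => // E; case/eqP: ni; apply: val_inj; rewrite /= E.
  rewrite mulr0 big1 // => i _; case: eqP => // E.
  by move: (ltn_ord i); rewrite -E ltnNge lt_nC.
transitivity (\sum_(w <- traces n) \sum_(C : {set V} | C \subset front_set w)
    ((-1) ^+ #|C| : int)).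
  under eq_bigr => C _ do rewrite -sum1_count -natz natr_sum mulr_sumr big_mkcond.
  rewrite exchange_big /=; apply: eq_bigr => w _.
  rewrite [LHS]big_mkcond [RHS]big_mkcond /=; apply: eq_bigr => C _.
  case: ifP => [_|KC]; first by case: ifP; rewrite ?mulr1.
  (* Front letters commute pairwise, so every subset of the front is already a clique. *)
  case: ifP => // /subsetP CF; case/negP: KC; apply/cliqueP => u v uC vC.
  have := CF u uC; have := CF v vC; rewrite !inE => fv fu.
  by apply: front_comm fu fv.
under eq_bigr do rewrite sum_powerset_sign front_set_eq0.
have c0 : canon [::] = [::].
  by apply/perm_nilP; rewrite perm_sym; apply/trace_eq_perm/canonP.
have [->|n0] := eqVneq n 0%N.
  rewrite (perm_big [:: [::]]) ?big_seq1 //; apply: uniq_perm => //.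
    exact: traces_uniq.
  move=> w; rewrite mem_traces inE; apply/andP/eqP=> [[_ /eqP w0]|->]; last first.
    by rewrite c0 /wordwt big_nil.
  by apply/nilP; rewrite /nilp -leqn0 -w0 leq_size_wordwt.
rewrite big_seq big1 // => w; rewrite mem_traces => /andP[_ /eqP wn].
by case: eqP => // w0; case/eqP: n0; rewrite -wn w0 /wordwt big_nil.
Qed.

End Traces.

(** * Signs of words and functionals vanishing on the ideal *)

Section GraphAlgebra.
Variables (k : fieldType) (G : wgraph).

Local Notation V := (vert G).
Local Notation free_alg := {malg k[{fmonom V}]}.
Local Notation teq := (trace_eq (@adjacent G)).
Local Notation wt := (@vweight G).
Implicit Types (a b : V) (s t w : seq V) (f r : free_alg).

Lemma adjacent_sym : symmetric (@adjacent G).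
Proof. by move=> a b; rewrite /adjacent setUC. Qed.

Lemma adjacent_irr : irreflexive (@adjacent G).
Proof.
move=> a; apply/existsP => -[j /eqP E]; have := no_loop j.
have: endl j \in [set endl j; endr j] by rewrite set21.
have: endr j \in [set endl j; endr j] by rewrite set22.
by rewrite E !inE !orbb => /eqP -> /eqP ->; rewrite eqxx.
Qed.

(** At most one edge joins a and b, so the choice made by [pick] is harmless. The default 1 keeps
    every value of square 1. *)
Definition edge_sign a b : k :=
  if [pick j | [set endl j; endr j] == [set a; b]] is Some j
  then (-1) ^+ eweight j else 1.

Lemma edge_sign_sym a b : edge_sign a b = edge_sign b a.
Proof. by rewrite /edge_sign setUC. Qed.

Lemma edge_signE (j : edge G) : edge_sign (endl j) (endr j) = (-1) ^+ eweight j.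
Proof.
rewrite /edge_sign; case: pickP => [i /eqP/(@no_multi_edge G) -> //|/(_ j)].
by rewrite eqxx.
Qed.

Lemma edge_sign_sqr a b : edge_sign a b * edge_sign a b = 1.
Proof.
rewrite /edge_sign; case: pickP => [j _|_]; last exact: mulr1.
by rewrite -expr2 sqrr_sign.
Qed.

Lemma edge_sign_neq0 a b : edge_sign a b != 0.
Proof.
by apply/eqP => E; move/eqP: (edge_sign_sqr a b); rewrite E mul0r eq_sym oner_eq0.
Qed.

(** [enum_rank] supplies an arbitrary total order on the vertices; the factors are the inversions of
    a with the letters after it. *)
Definition inversion_sign a w : k :=
  \prod_(b <- w | (enum_rank b < enum_rank a)%N) edge_sign a b.

(* Exchanging two adjacent distinct letters changes the status of exactly one  *)
(* inversion, so this sign turns the graded commutation rule into equality.    *)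
Fixpoint word_sign w : k :=
  if w is a :: s then inversion_sign a s * word_sign s else 1.

Lemma word_sign_neq0 w : word_sign w != 0.
Proof.
elim: w => [|a w IHw] /=; first exact: oner_neq0.
rewrite mulf_neq0 //; apply: (big_ind (fun x => x != 0)) => //.
- exact: oner_neq0.
- by move=> x y; apply: mulf_neq0.
by move=> b _; apply: edge_sign_neq0.
Qed.

Lemma word_sign_swap a b s w : a != b ->
  word_sign (s ++ [:: a, b & w]) = edge_sign a b * word_sign (s ++ [:: b, a & w]).
Proof.
move=> ab; elim: s => [|c s IHs] /=; last first.
  (* The inversions of an earlier letter c depend only on the multiset of letters that follow it. *)
  rewrite IHs mulrCA; congr (_ * (_ * _)); apply: perm_big.
  by rewrite perm_cat2l -(cat1s a) -(cat1s b) perm_catCA.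
rewrite /inversion_sign !big_cons -/(inversion_sign a w) -/(inversion_sign b w).
have {}ab : enum_rank a != enum_rank b by rewrite (inj_eq enum_rank_inj).
(* The pair a, b is an inversion in exactly one of the two words; as the edge sign is its own
   inverse, both cases give the same ratio. *)
case: (ltngtP (enum_rank a) (enum_rank b)) => [_|_|E];
  last by case/eqP: ab; apply: val_inj.
  rewrite [edge_sign b a]edge_sign_sym !mulrA edge_sign_sqr mul1r.
  by congr (_ * _); rewrite mulrC.
by rewrite !mulrA; congr (_ * _); rewrite mulrAC.
Qed.

Definition mono w : free_alg := << FMonom w >>.

Lemma mono_cat s t : mono (s ++ t) = mono s * mono t.
Proof.
rewrite malgM_def fgmulUU mulr1; congr << _ >>; apply/eqP.
by rewrite fmP fmM.
Qed.

Lemma gen_mono a : gen k a = mono [:: a].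
Proof. by rewrite /gen fmuE. Qed.

Lemma mcoeff_mono w m : (mono w)@_m = (FMonom w == m)%:R.
Proof. exact: mcoeffU. Qed.

Lemma malg_mono f : f = \sum_(m <- msupp f) f@_m *: mono m.
Proof.
rewrite {1}[f]monalgE; apply: eq_bigr => m _; apply/malgP => m'.
by rewrite mcoeffZ mcoeff_mono mcoeffU fmK mulr_natr.
Qed.

Lemma relator_mono (j : edge G) : relator k j =
  mono [:: endl j; endr j] - (-1) ^+ eweight j *: mono [:: endr j; endl j].
Proof. by rewrite /relator !gen_mono -!mono_cat. Qed.

(** Restricting to words of the weight of s makes the sum finite and loses no word of the trace of
    s. *)
Definition trace_coef s f : k :=
  \sum_(w <- words wt (wordwt wt s) | teq s w) word_sign w * f@_(FMonom w).

Lemma trace_coef_linear s : linear_for *%R (trace_coef s).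
Proof.
move=> c f r; rewrite /trace_coef mulr_sumr -big_split /=; apply: eq_bigr => w _.
by rewrite mcoeffD mcoeffZ mulrDr mulrCA.
Qed.

HB.instance Definition _ s :=
  GRing.isLinear.Build k free_alg k *%R (trace_coef s) (trace_coef_linear s).

Lemma trace_coefZ s c f : trace_coef s (c *: f) = c * trace_coef s f.
Proof. exact: linearZ. Qed.

Lemma trace_coef_mono s w :
  trace_coef s (mono w) = if teq s w then word_sign w else 0.
Proof.
rewrite /trace_coef; case: ifPn => [sw|nsw].
  have w_in : w \in words wt (wordwt wt s).
    by rewrite (mem_words (@vweight_gt0 G)) (eq_wordwt adjacent_irr _ sw).
  rewrite big_mkcond (bigD1_seq w) //= ?words_uniq // sw mcoeff_mono eqxx mulr1.
  rewrite big1 ?addr0 // => t tw; rewrite mcoeff_mono.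
  by case: ifP => // _; case: eqP => [[E]|]; rewrite ?mulr0 // E eqxx in tw *.
rewrite big1 // => t st; rewrite mcoeff_mono.
by case: eqP => [[E]|]; rewrite ?mulr0 //; rewrite E st in nsw.
Qed.

(** Both monomials of the product lie in the same trace, and the ratio of their word signs is the
    sign in the relator, so they cancel. *)
Lemma trace_coef_relator s t1 t2 (j : edge G) :
  trace_coef s (mono t1 * relator k j * mono t2) = 0.
Proof.
rewrite relator_mono mulrBr mulrBl -free_scaleAr -scalerAl -!mono_cat -!catA /=.
have adj : adjacent (endl j) (endr j) by apply/existsP; exists j.
rewrite linearB /= trace_coefZ !trace_coef_mono word_sign_swap ?no_loop //.
have E := trace_eq_swap adjacent_sym adjacent_irr t2 adj.
rewrite -(trace_eq_catl _ t1) in E.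
have -> : teq s (t1 ++ [:: endl j, endr j & t2])
        = teq s (t1 ++ [:: endr j, endl j & t2]).
  by apply/idP/idP => /trace_eq_trans; apply => //; rewrite trace_eq_sym.
by rewrite edge_signE; case: ifP => _; rewrite ?mulr0 subrr.
Qed.

Lemma trace_coef_ideal s r : r \in @rel_ideal k G -> trace_coef s r = 0.
Proof.
move/rel_idealP=> [l ->]; rewrite linear_sum big1 // => -[[f j] g] _ /=.
move: (relator k j) (fun t1 t2 => trace_coef_relator s t1 t2 j) => x x0.
rewrite [f]malg_mono [g]malg_mono; apply: sum_mul_sum_eq0 => m m'.
by rewrite /= -free_scaleAr -!scalerAl !trace_coefZ x0 !mulr0.
Qed.

(** * Spanning, and the dimension of the graded pieces *)

Definition word_class w : quot_alg k G := proj (mono w).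

Lemma word_class_cat s t : word_class (s ++ t) = word_class s * word_class t.
Proof. by rewrite /word_class mono_cat rmorphM. Qed.

Lemma word_class_cons a w : word_class (a :: w) = word_class [:: a] * word_class w.
Proof. exact: (word_class_cat [:: a]). Qed.

Lemma word_class_consZ a c w1 w2 : word_class w1 = c *: word_class w2 ->
  word_class (a :: w1) = c *: word_class (a :: w2).
Proof.
move=> E; rewrite (word_class_cons a w1) (word_class_cons a w2) E.
exact/esym/quot_scaleAr.
Qed.

Lemma word_class_edge (j : edge G) :
  word_class [:: endl j; endr j] = (-1) ^+ eweight j *: word_class [:: endr j; endl j].
Proof.
rewrite /word_class -linearZ; apply/projP; rewrite -relator_mono.
by apply/rel_idealP; exists [:: (1, j, 1)]; rewrite big_seq1 mul1r mulr1.
Qed.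

Lemma adjacentP a b : adjacent a b ->
  exists j : edge G, (endl j = a /\ endr j = b) \/ (endl j = b /\ endr j = a).
Proof.
case/existsP=> j /eqP E; exists j; have := no_loop j.
have: endl j \in [set endl j; endr j] by rewrite set21.
have: endr j \in [set endl j; endr j] by rewrite set22.
rewrite E !inE => /orP[]/eqP -> /orP[]/eqP ->; rewrite ?eqxx //; by [left | right].
Qed.

Lemma word_class_swap a b w : adjacent a b ->
  exists c, word_class [:: a, b & w] = c *: word_class [:: b, a & w].
Proof.
move=> ab; suff [c Ec] : exists c, word_class [:: a; b] = c *: word_class [:: b; a].
  exists c; rewrite (word_class_cat [:: a; b]) (word_class_cat [:: b; a]).
  by rewrite Ec scalerAl.
have [j [] [<- <-]] := adjacentP ab; exists ((-1) ^+ eweight j).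
  exact: word_class_edge.
by rewrite word_class_edge scalerA -expr2 sqrr_sign scale1r.
Qed.

Lemma word_class_front b w : front (@adjacent G) b w ->
  exists c, word_class (b :: rem b w) = c *: word_class w.
Proof.
elim: w => //= a w IHw; have [->|nab /=] := eqVneq a b.
  by exists 1; rewrite scale1r.
case/andP=> ab /IHw[c Ec]; have [|d Ed] := @word_class_swap b a (rem b w).
  by rewrite adjacent_sym.
exists (d * c); rewrite Ed (word_class_consZ a Ec); apply: scalerA.
Qed.

(** Induction on [w1], bringing its first letter to the front of [w2]. The scalar may stay
    unspecified, since this serves only for spanning. *)
Lemma word_class_trace_eq w1 w2 : teq w1 w2 ->
  exists c, word_class w1 = c *: word_class w2.
Proof.
elim: w1 w2 => [|b w1 IHw] w2 E.
  have /(trace_eq_perm adjacent_irr)/perm_nilP -> : teq w2 [::].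
    by rewrite trace_eq_sym.
  by exists 1; rewrite scale1r.
have Fb : front (@adjacent G) b w2.
  by rewrite -(eq_front adjacent_sym adjacent_irr b E) /= eqxx.
have [|c Ec] := IHw (rem b w2).
  rewrite -(trace_eq_cons _ b); apply: trace_eq_trans E _.
  exact: (front_rem adjacent_sym adjacent_irr).
have [d Ed] := word_class_front Fb.
exists (c * d); rewrite (word_class_consZ b Ec) Ed; apply: scalerA.
Qed.

Local Notation gtraces := (traces (@adjacent G) wt).

Lemma quot_piece_dim n : has_dim (@quot_piece k G n) (size (gtraces n)).
Proof.
pose T i := nth [::] (gtraces n) i.
have Tin (i : 'I_(size (gtraces n))) : T i \in gtraces n by exact: mem_nth.
exists (fun i => word_class (T i)); split => [i|c c0 i|x [f fn <-]].
- exists (mono (T i)) => // m; rewrite msuppU oner_eq0 inE => /eqP -> /=.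
  by have := Tin i; rewrite (mem_traces _ (@vweight_gt0 G)) => /andP[_ /eqP].
- have : \sum_j c j *: mono (T j) \in @rel_ideal k G.
    rewrite -[X in X \in _]subr0; apply/projP; rewrite linear_sum linear0 -[RHS]c0.
    by apply: eq_bigr => j _; rewrite linearZ.
  (* The functional of the trace of [T i] kills the other representatives and leaves c i times a
     nonzero sign. *)
  move/(trace_coef_ideal (T i)); rewrite linear_sum (bigD1 i) //= big1 => [|j ji].
    rewrite addr0 trace_coefZ trace_coef_mono trace_eq_refl => /eqP.
    by rewrite mulf_eq0 (negPf (word_sign_neq0 _)) orbF => /eqP.
  rewrite trace_coefZ trace_coef_mono; case: ifP => [E|_]; last by rewrite mulr0.
  have := Tin i; have := Tin j; rewrite !(mem_traces _ (@vweight_gt0 G)).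
  move=> /andP[/eqP cj _] /andP[/eqP ci _]; case/eqP: ji; apply: val_inj.
  apply/eqP; rewrite -(nth_uniq [::] (ltn_ord _) (ltn_ord _) (traces_uniq _ _ _)).
  by rewrite -/(T i) -/(T j) -ci -cj (eq_canon E).
rewrite [f]malg_mono linear_sum big_seq.
pose span (x : quot_alg k G) :=
  exists c : 'I_(size (gtraces n)) -> k, x = \sum_i c i *: word_class (T i).
apply: (big_ind span) => [|y z [c ->] [d ->]|m mf].
- by exists (fun=> 0); rewrite big1 // => i _; rewrite scale0r.
- exists (fun i => c i + d i); rewrite -big_split; apply: eq_bigr => i _ /=.
  by rewrite scalerDl.
have [c Ec] := word_class_trace_eq (canonP (@adjacent G) m).
have : canon (@adjacent G) m \in gtraces n.
  by rewrite -(fn m mf); apply: (canon_traces adjacent_irr (@vweight_gt0 G)).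
(* A monomial m of f contributes only at the index of its normal form. *)
rewrite -index_mem => lt_i; exists (fun i => (f@_m * c) *+ (i == Ordinal lt_i)).
rewrite (bigD1 (Ordinal lt_i)) //= eqxx mulr1n big1 => [|i /negPf ->].
  rewrite addr0 linearZ /= -/(word_class m) Ec scalerA /T nth_index //.
  by rewrite -index_mem.
by rewrite mulr0n scale0r.
Qed.

(** Each clique C is counted for exactly one pair (i, j), namely its size and its weight, and both
    lie within the bounds of the double sum. *)
Lemma coef_clique_poly n : (clique_poly G)`_n = clique_coef (@adjacent G) wt n.
Proof.
pose term C : int := (-1) ^+ #|C : {set V}| *+ (setwt wt C == n).
transitivity (\sum_(C | @is_clique G C) term C); last first.
  by rewrite /clique_coef big_mkcondr; apply: eq_bigr => C _; rewrite /term mulrb.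
transitivity (\sum_(i < #|V|.+1) \sum_(j < (\sum_v wt v)%N.+1)
    \sum_(C | [&& @is_clique G C, #|C| == i & setwt wt C == j]) term C).
  rewrite coef_sum; apply: eq_bigr => i _; rewrite coef_sum; apply: eq_bigr => j _.
  rewrite coefZ coefXn /clique_count -sum1_card -natz natr_sum mulr_sumr mulr_suml.
  apply: eq_big => [C|C]; rewrite inE // => /and3P[_ /eqP <- /eqP <-].
  by rewrite mulr1 /term eq_sym mulr_natr.
transitivity (\sum_(i < #|V|.+1) \sum_(C | @is_clique G C)
    \sum_(j < (\sum_v wt v)%N.+1)
      if (#|C| == i) && (setwt wt C == j) then term C else 0).
  apply: eq_bigr => i _; rewrite [RHS]exchange_big; apply: eq_bigr => j _.
  exact: big_mkcondr.
rewrite exchange_big /=; apply: eq_bigr => C KC.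
have lti : (#|C| < #|V|.+1)%N by rewrite ltnS max_card.
have ltj : (setwt wt C < (\sum_v wt v)%N.+1)%N.
  by rewrite ltnS /setwt [X in (X <= _)%N]big_mkcond; apply: leq_sum => v _; case: ifP.
rewrite (bigD1 (Ordinal lti)) //= [X in _ + X]big1 ?addr0 => [|i ni].
  rewrite (bigD1 (Ordinal ltj)) //= !eqxx big1 ?addr0 // => j nj.
  by case: eqP => // E; case/eqP: nj; apply: val_inj; rewrite /= E.
rewrite big1 // => j _; case: eqP => //= E.
by case/eqP: ni; apply: val_inj; rewrite /= E.
Qed.

End GraphAlgebra.

Lemma fps_mulC f g : fps_mul f g =1 fps_mul g f.
Proof.
move=> n; rewrite /fps_mul (reindex_inj rev_ord_inj) /=; apply: eq_bigr => i _.
by rewrite subSS subKn -1?ltnS // mulrC.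
Qed.

Theorem theorem5p1 (k : fieldType) (char_neq2 : 2%N \notin [pchar k]%R)
    (G : wgraph) :
  exists H : nat -> int,
    is_hilbert_series (@quot_piece k G) H /\
    is_fps_inverse (fps_of_poly (clique_poly G)) H.
Proof.
pose H n : int := (size (traces (@adjacent G) (@vweight G) n))%:Z.
exists H; split=> [n|].
  by exists (size (traces (@adjacent G) (@vweight G) n)) => //; apply: quot_piece_dim.
suff E : fps_mul (fps_of_poly (clique_poly G)) H =1 fps_one.
  by split=> // n; rewrite fps_mulC.
move=> n; rewrite /fps_mul /fps_one.
rewrite -(clique_traces_inverse (@adjacent_sym G) (@adjacent_irr G) (@vweight_gt0 G) n).
by apply: eq_bigr => i _; rewrite /fps_of_poly coef_clique_poly.
Qed.
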